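(* Let $0\to M\xrightarrow{\rho}\mathbf{Z}^n\xrightarrow{\phi}\mathbf{D}\to 0$ be an exact sequence of abelian groups, and regard $M$ as a subgroup of $\mathbf{Z}^n$ via $\rho$. Let $I\subset\{1,\dots,n\}$ and let $I'$ be the complement of $I$ in $\{1,\dots,n\}$. The following are equivalent: (a) For every $p\in\mathbf{Z}^n$, the set $(p+M)\cap L_I$ is finite. (b) $M\cap C_I=0$. (b') $M\cap C_{I'}=0$. (c) For any $p,q,r\in\mathbf{Z}^n$ such that $q\neq r$ and $q,r\in(p+M)\cap C_I$, there are indices $i,j$ such that $|q_i|>|r_i|$ and $|q_j|<|r_j|$. (d) For every $p\in\mathbf{Z}^n$, the set $(p+M)\cap C_I$ is finite. (d') For some $p\in\mathbf{Z}^n$, the set $(p+M)\cap C_I$ is finite and nonempty.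
   Context: For $I\subset\{1,\dots,n\}$: $L_I=\{p\in\mathbf{Z}^n\mid \{j\mid p_j<0\}=I\}$, and $C_I\subset\mathbf{Z}^n$ is the orthant $C_I=\{p\in\mathbf{Z}^n\mid p_j\le 0\text{ for }j\in I,\ p_j\ge 0\text{ for }j\notin I\}$. *)

(* Defs.v *)
From HB Require Import structures.
From mathcomp Require Import all_boot all_order all_algebra.
From mathcomp Require Import boolp classical_sets functions cardinality.

Set Implicit Arguments.
Unset Strict Implicit.
Unset Printing Implicit Defensive.

Import Order.TTheory GRing.Theory Num.Theory.
Local Open Scope classical_set_scope.
Local Open Scope ring_scope.

(* The lattice Z^n is 'rV[int]_n, with coordinates indexed by 'I_n, that is by
   0, ..., n-1 instead of 1, ..., n. *)

Definition short_exact (A B C : zmodType)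
    (f : {additive A -> B}) (g : {additive B -> C}) : Prop :=
  [/\ injective f, range f = g @^-1` [set 0] & range g = setT].

Definition cell (n : nat) (I : {set 'I_n}) : set 'rV[int]_n :=
  [set p | [set j | p ord0 j < 0]%SET = I].

Definition orthant (n : nat) (I : {set 'I_n}) : set 'rV[int]_n :=
  [set p | (forall j, j \in I -> p ord0 j <= 0) /\
           (forall j, j \notin I -> 0 <= p ord0 j)].

Definition translate (V : zmodType) (p : V) (A : set V) : set V :=
  [set p + x | x in A].

(* Main.v *)
Require Import Defs.
From HB Require Import structures.
From mathcomp Require Import all_boot all_order all_algebra.
From mathcomp Require Import boolp classical_sets functions cardinality.

Set Implicit Arguments.
Unset Strict Implicit.
Unset Printing Implicit Defensive.

Import Order.TTheory GRing.Theory Num.Theory.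
Local Open Scope classical_set_scope.
Local Open Scope ring_scope.

(** Write [M] for the image of [rho], a subgroup of [Z^n].  The orthant [C_I] is
    a submonoid of [Z^n], and everything turns on whether it contains a nonzero
    element of [M].

    If it does, say [m], then the ray [p + k m] ([k >= 0]) is infinite, lies in
    a single coset of [M], and stays in [C_I] as soon as [p] is in [C_I]; it
    even stays in the cell [L_I] if [p] is in [L_I] ([infinite_ray],
    [orthantDMn], [cellDMn]).  So (a) and (d') each imply (b).

    If it does not, compare two distinct points [q], [r] of [C_I] in the same
    coset.  Inside an orthant, coordinatewise domination of absolute values
    means that the difference lies in that orthant ([orthantB]), so neither
    point dominates the other, which is (c).  Thus each coset meets [C_I] in an
    antichain for domination, and by Dickson's lemma ([dickson], with [Z^n]
    mapped to [N^n] by absolute values) such an antichain is finite, which is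
    (d).  Then (d') follows with [p = 0], and (a) because [L_I] is contained in
    [C_I].  Passing from [I] to its complement is negation, a bijection of [M]
    that exchanges the two orthants, whence (b'). *)

(** * Dickson's lemma *)

(** The next index is always chosen as one at which [g] is minimal among all the
    later indices, so every value chosen afterwards is at least as large. *)
Lemma nondecreasing_subsequence (g : nat -> nat) :
  exists s : nat -> nat, {homo s : i j / (i < j)%N} /\
                         {homo g \o s : i j / (i <= j)%N}.
Proof.
have tail_min N : exists i, (N <= i)%N /\ forall j, (N <= j)%N -> (g i <= g j)%N.
  have exv : exists v, `[< exists2 i, (N <= i)%N & g i = v >].
    by exists (g N); apply/asboolP; exists N.
  case: (ex_minnP exv) => v /asboolP[i leNi <-] min_v.
  by exists i; split=> // j leNj; apply: min_v; apply/asboolP; exists j.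
have [h hP] := choice tail_min.
pose s := fix s k := if k is k'.+1 then h (s k').+1 else h 0%N.
have s_lt : {homo s : i j / (i < j)%N}.
  by apply: homo_ltn => [|i]; [exact: ltn_trans | case: (hP (s i).+1)].
have s_min i j : (s i <= j)%N -> (g (s i) <= g j)%N.
  have [N ->] : exists N, s i = h N by case: i => [|i]; eexists.
  by case: (hP N) => leNh h_min le_hj; apply/h_min/(leq_trans leNh).
exists s; split=> // i j le_ij; apply: s_min.
exact: (ltnW_homo s_lt).
Qed.

(** Extract subsequences for one function after another: a subsequence of a
    nondecreasing sequence is still nondecreasing. *)
Lemma nondecreasing_subsequence_all (fs : seq (nat -> nat)) :
  exists s : nat -> nat, {homo s : i j / (i < j)%N} /\
    forall k, (k < size fs)%N -> {homo nth id fs k \o s : i j / (i <= j)%N}.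
Proof.
elim: fs => [|f fs [s [s_lt s_fs]]]; first by exists id; split.
have [t [t_lt t_f]] := nondecreasing_subsequence (f \o s).
have t_le := ltnW_homo t_lt.
exists (s \o t); split=> [i j lt_ij|[|k] ltk i j le_ij]; first by apply/s_lt/t_lt.
  exact: t_f.
exact: (s_fs k ltk _ _ (t_le _ _ le_ij)).
Qed.

(** The finiteness of antichains, in contrapositive form: the first two terms of
    a subsequence along which all the [f i] are nondecreasing are comparable. *)
Lemma dickson (T : Type) (I : finType) (f : I -> T -> nat) (A : set T) :
  infinite_set A ->
  exists x y, [/\ A x, A y, x <> y & forall i, (f i x <= f i y)%N].
Proof.
move=> /infiniteP/card_leP[u]; pose v k := val (u (SigSub (in_setT k))).
have v_inj : injective v by move=> k l /val_inj/(inj (in_setT _) (in_setT _)) [].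
have vA k : A (v k) by exact: set_valP.
have [s [s_lt s_fs]] :=
  nondecreasing_subsequence_all [seq f i \o v | i <- enum I].
exists (v (s 0%N)), (v (s 1%N)); split=> // [/v_inj eq_s|i].
  by have := s_lt 0%N 1%N isT; rewrite eq_s ltnn.
have lti : (enum_rank i < size [seq f i \o v | i <- enum I])%N.
  by rewrite size_map -cardE.
have := s_fs _ lti 0%N 1%N isT.
by rewrite /= (nth_map i) -?cardE // nth_enum_rank.
Qed.

(** * Orthants and cells *)

(** The ray is injective in [k] because [Z^n] is torsion-free. *)
Lemma infinite_ray (n : nat) (p m : 'rV[int]_n) (A : set 'rV[int]_n) :
  m <> 0 -> (forall k, A (p + m *+ k)) -> infinite_set A.
Proof.
move=> m_neq0 Aray; have [j mj] : exists j, m ord0 j != 0.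
  apply: contrapT => /forallNP m0; apply: m_neq0; apply/rowP => j.
  by rewrite mxE; apply/eqP/negPn/negP/m0.
apply: (@sub_infinite_set _ (range (fun k => p + m *+ k))).
  by move=> _ [k _ <-].
have ray_inj : {in setT &, injective (fun k => p + m *+ k)}.
  move=> k l _ _ /addrI /(congr1 (fun q : 'rV[int]_n => q ord0 j)).
  by rewrite !mulmxnE; exact: (mulrIn mj).
by rewrite (eq_finite_set (inj_card_eq ray_inj)); exact: infinite_nat.
Qed.

Section Orthants.
Variables (n : nat) (I : {set 'I_n}).
Implicit Types p q m : 'rV[int]_n.

Lemma orthant0 : orthant I 0.
Proof. by split=> j _; rewrite mxE. Qed.

Lemma orthantDMn p m k : orthant I p -> orthant I m -> orthant I (p + m *+ k).
Proof.
move=> [pI pI'] [mI mI']; split=> j jI; rewrite mxE mulmxnE.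
  by rewrite ler_wnDr ?pI ?mulrn_wle0 ?mI.
by rewrite addr_ge0 ?pI' ?mulrn_wge0 ?mI'.
Qed.

Lemma orthantN p : orthant (~: I)%SET (- p) <-> orthant I p.
Proof.
split=> -[h h']; split=> j jI.
- by have := h' j; rewrite inE jI mxE oppr_ge0; apply.
- by have := h j; rewrite inE jI mxE oppr_le0; apply.
- by rewrite mxE oppr_le0; apply: h'; rewrite inE in jI.
- by rewrite mxE oppr_ge0; apply: h; rewrite inE negbK in jI.
Qed.

(** On an orthant each coordinate has a fixed sign, so comparing two absolute
    values is comparing the coordinates themselves, up to that sign. *)
Lemma orthantB p q : orthant I p -> orthant I q ->
  (forall j, `|p ord0 j| <= `|q ord0 j|) -> orthant I (q - p).
Proof.
move=> [pI pI'] [qI qI'] le_pq; split=> j jI; have := le_pq j; rewrite !mxE.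
  by rewrite !ler0_norm ?pI ?qI // lerN2 subr_le0.
by rewrite !ger0_norm ?pI' ?qI' // subr_ge0.
Qed.

Lemma cell_orthant : cell I `<=` orthant I.
Proof.
move=> p /= <-; split=> j; rewrite inE; first exact: ltW.
by rewrite -leNgt.
Qed.

(** A direction in the orthant never pushes a coordinate across the wall between
    negative and nonnegative: it can only lower those in [I], which are already
    negative, and only raise the others. *)
Lemma cellDMn p m k : cell I p -> orthant I m -> cell I (p + m *+ k).
Proof.
move=> /= pI [mI mI']; apply/setP => j; rewrite inE mxE mulmxnE.
have := congr1 (fun J : {set 'I_n} => j \in J) pI; rewrite inE.
case: (boolP (j \in I)) => jI.
  by move=> pj; rewrite ltr_wnDr ?mulrn_wle0 ?mI.
move/negbT; rewrite -leNgt => pj; apply/negbTE.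
by rewrite -leNgt addr_ge0 ?mulrn_wge0 ?mI'.
Qed.

Lemma cell_nonempty : cell I !=set0.
Proof.
exists (\row_j (- (j \in I)%:R)) => /=; apply/setP => j.
by rewrite inE mxE oppr_lt0 ltr0n lt0b.
Qed.

End Orthants.

(** * Cosets of a subgroup *)

Section Cosets.
Variables (n : nat) (M : zmodType) (rho : {additive M -> 'rV[int]_n}).
Implicit Types (p q m : 'rV[int]_n) (I : {set 'I_n}).

Let G := range rho.

Lemma range_orthant0 I :
  (forall m, G m -> orthant I m -> m = 0) -> G `&` orthant I = [set 0].
Proof.
move=> triv; apply/seteqP; split=> [m [Gm Im]|_ ->]; first exact: triv.
by split; [exists 0; rewrite ?raddf0 | exact: orthant0].
Qed.

Lemma range_opp m : G m -> G (- m).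
Proof. by move=> [x _ <-]; exists (- x); rewrite ?raddfN. Qed.

Lemma translateDMn p q m k :
  translate p G q -> G m -> translate p G (q + m *+ k).
Proof.
move=> [_ [x _ <-] <-] [y _ <-]; rewrite -addrA; exists (rho x + rho y *+ k) => //.
by exists (x + y *+ k); rewrite // raddfD raddfMn.
Qed.

Lemma translateB p q r : translate p G q -> translate p G r -> G (q - r).
Proof.
move=> [_ [x _ <-] <-] [_ [y _ <-] <-]; exists (x - y) => //.
by rewrite raddfB opprD addrACA subrr add0r.
Qed.

Lemma translate_refl p : translate p G p.
Proof. by exists 0; rewrite ?addr0 //; exists 0; rewrite ?raddf0. Qed.

(** A nonzero element of [C_I] in the subgroup would turn the point [q] into a
    ray inside the finite set.  The set [S] stands for [L_I] or [C_I], so that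
    (a) and (d') are treated at once. *)
Lemma range_orthant_eq0 I (S : set 'rV[int]_n) p q :
  (forall q m k, S q -> orthant I m -> S (q + m *+ k)) ->
  finite_set (translate p G `&` S) -> (translate p G `&` S) q ->
  G `&` orthant I = [set 0].
Proof.
move=> Sray finS [pq Sq]; apply: range_orthant0 => m Gm Im.
apply: contrapT => m_neq0; apply: (infinite_ray (p := q) m_neq0 _ finS) => k.
by split; [exact: translateDMn | exact: Sray].
Qed.

Lemma range_orthantC I :
  G `&` orthant I = [set 0] -> G `&` orthant (~: I)%SET = [set 0].
Proof.
move=> GI0; apply: range_orthant0 => m Gm Im; apply: oppr_inj; rewrite oppr0.
suff : (G `&` orthant I) (- m) by rewrite GI0.
split; first exact: range_opp.
by apply/orthantN; rewrite opprK.
Qed.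

(** The difference [r - q] is in the subgroup, and by domination in [C_I]. *)
Lemma dominated_eq I p q r : G `&` orthant I = [set 0] ->
  (translate p G `&` orthant I) q -> (translate p G `&` orthant I) r ->
  (forall j, `|q ord0 j| <= `|r ord0 j|) -> q = r.
Proof.
move=> GI0 [pq Iq] [pr Ir] le_qr; apply/esym/subr0_eq.
suff : (G `&` orthant I) (r - q) by rewrite GI0.
by split; [exact: translateB pr pq | exact: orthantB].
Qed.

End Cosets.

(** * Equivalence of the finiteness conditions *)

Theorem proposition1p4 (n : nat) (M D : zmodType)
    (rho : {additive M -> 'rV[int]_n}) (phi : {additive 'rV[int]_n -> D})
    (hex : short_exact rho phi) (I : {set 'I_n}) :
  [<->
   (* a *)
   forall p : 'rV[int]_n, finite_set (translate p (range rho) `&` cell I);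
   (* b *)
   range rho `&` orthant I = [set 0];
   (* b' *)
   range rho `&` orthant (~: I)%SET = [set 0];
   (* c *)
   forall p q r : 'rV[int]_n, q <> r ->
     (translate p (range rho) `&` orthant I) q ->
     (translate p (range rho) `&` orthant I) r ->
     exists i j : 'I_n, `|q ord0 i| > `|r ord0 i| /\ `|q ord0 j| < `|r ord0 j|;
   (* d *)
   forall p : 'rV[int]_n, finite_set (translate p (range rho) `&` orthant I);
   (* d' *)
   exists p : 'rV[int]_n,
     finite_set (translate p (range rho) `&` orthant I) /\
     translate p (range rho) `&` orthant I !=set0 ].
Proof.
pose GI p := translate p (range rho) `&` orthant I.
have bT : range rho `&` orthant (~: I)%SET = [set 0] ->
          range rho `&` orthant I = [set 0].
  by move=> /range_orthantC; rewrite finset.setCK.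
have cd : (forall p q r : 'rV[int]_n, q <> r -> GI p q -> GI p r ->
    exists i j, `|q ord0 i| > `|r ord0 i| /\ `|q ord0 j| < `|r ord0 j|) ->
    forall p, finite_set (GI p).
  move=> c p; apply: contrapT.
  move=> /(dickson (fun (j : 'I_n) (q : 'rV[int]_n) => `|q ord0 j|%N)).
  move=> [q [r [pq pr neq_qr le_qr]]].
  have [i [_ [lt_rq _]]] := c p q r neq_qr pq pr.
  by move: lt_rq; rewrite ltNge -!abszE lez_nat le_qr.
have bc : range rho `&` orthant I = [set 0] ->
    forall p q r : 'rV[int]_n, q <> r -> GI p q -> GI p r ->
    exists i j, `|q ord0 i| > `|r ord0 i| /\ `|q ord0 j| < `|r ord0 j|.
  move=> b p q r neq_qr pq pr.
  have not_dominated x y : GI p x -> GI p y -> x <> y ->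
      exists i, `|y ord0 i| < `|x ord0 i|.
    move=> px py neq_xy; apply: contrapT => /forallNP le_xy; apply: neq_xy.
    apply: dominated_eq b px py _ => j.
    by rewrite leNgt; apply/negP/le_xy.
  have [i lt_i] := not_dominated q r pq pr neq_qr.
  by have [j lt_j] := not_dominated r q pr pq (nesym neq_qr); exists i, j.
tfae.
- move=> a; have [p Ip] := cell_nonempty I.
  apply: (range_orthant_eq0 (@cellDMn n I) (a p)).
  by split; [exact: translate_refl | exact: Ip].
- exact: range_orthantC.
- by move=> /bT/bc.
- exact: cd.
- move=> d; exists 0; split; first exact: d.
  by exists 0; split; [exact: translate_refl | exact: orthant0].
- move=> [p [finp [q pq]]] p'.
  have b := range_orthant_eq0 (@orthantDMn n I) finp pq.
  by apply: sub_finite_set (cd (bc b) p'); apply: setIS; exact: cell_orthant.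
Qed.
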